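(* Assume that $g$ is Lipschitz-continuous with a constant $\ell_g>0$ and that the stabilization parameter satisfies $\kappa\ge2\ell_g$. Let $\tau>0$. Consider the three-stage scheme ($s=3$) $$U^{n,i+1}=U^{n,1}+\sum_{j=1}^{i}\hat a_{i+1,j}(-\tau L_\kappa)\big[\tau g_\kappa(U^{n,j})-\tau L_\kappa U^{n,1}\big],\quad 1\le i\le 3,\qquad U^{n,1}=u_h^{n-1},\ u_h^n=U^{n,4},\ n\ge1,$$ with coefficient matrix $\widehat A(z)=[\hat a_{i+1,j}(z)]_{i,j=1}^3$ given by either of (TIF3-Heun) $$\widehat A(z)=\begin{pmatrix}\frac1{3-z}&0&0\\ 0&\frac{2}{3e^{z/3}-2z}&0\\ \frac{e^{2z/3}}{e^{2z/3}(4-z)-3z}&0&\frac{3}{e^{2z/3}(4-z)-3z}\end{pmatrix},$$ (NIF3-Heun) $$\widehat A(z)=\begin{pmatrix}\frac{e^{z/3}-1}{z}&0&0\\ 0&\frac{e^{2z/3}-1}{z}&0\\ \frac{e^z}4&0&\frac{e^z-1}{z}-\frac{e^z}4\end{pmatrix}.$$ Then both the TIF3-Heun and the NIF3-Heun schemes preserve the original energy dissipation law at all stages (in the sense defined in the context).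
   Context: Setting: $L_h$ is a symmetric positive definite real $M\times M$ matrix (a spatial discretization of a stiff linear operator). $G$ is a non-negative differentiable (Lyapunov) function and $g(v)=-\frac{\delta}{\delta v}G(v)$, i.e. $g=-G'$; both $G$ and $g$ act componentwise on vectors in $\mathbb{R}^M$. The inner product is $\langle u,v\rangle:=v^Tu$. The original energy is $E[u]:=\frac12\langle u,L_hu\rangle+\langle G(u),1\rangle$, where $1$ is the all-ones vector; the problem $u_h'+L_hu_h=g(u_h)$ is the gradient flow $\frac{du_h}{dt}=-\frac{\delta E}{\delta u_h}$, with $\frac{dE}{dt}=-\langle\frac{du_h}{dt},\frac{du_h}{dt}\rangle\le0$. For $\kappa\ge0$ put $L_\kappa:=L_h+\kappa I$, $g_\kappa(u):=\kappa u+g(u)$, so the gradient flow is equivalently $u_h'=-L_\kappa u_h+g_\kappa(u_h)$. Functions $f(-\tau L_\kappa)$ are matrix functions of the symmetric matrix $-\tau L_\kappa$ (spectrum in $(-\infty,0)$). Differentiation matrix: for an $s$-stage scheme of the displayed form, let $\widehat A(z):=[\hat a_{i+1,j}(z)]_{i,j=1}^s$ (lower triangular, with zero entries for $j>i$), $E_s:=(1_{i\ge j})_{s\times s}$ the lower triangular all-ones matrix, $I$ the identity, and $$D(z):=\widehat A(z)^{-1}E_s+zE_s-\frac z2I .$$ $D_j(z):=D[1:j,1:j]$ is its $j$-th leading principal submatrix, and $D_j(-\tau L_\kappa)$ is the $j\times j$ block matrix obtained by replacing each scalar entry $d_{k\ell}(z)$ with the matrix $d_{k\ell}(-\tau L_\kappa)$.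 Put $\delta_\tau U^{n,\ell+1}:=U^{n,\ell+1}-U^{n,\ell}$ and $\delta_\tau\vec U_{n,j+1}:=(\delta_\tau U^{n,2},\dots,\delta_\tau U^{n,j+1})^T$. The scheme ''preserves the original energy dissipation law at all stages'' means: for all $n\ge1$ and $1\le j\le s$, $$E[U^{n,j+1}]-E[U^{n,1}]\le-\frac1\tau\big\langle\delta_\tau\vec U_{n,j+1},\,D_j(-\tau L_\kappa)\,\delta_\tau\vec U_{n,j+1}\big\rangle\le 0,$$ where the inner product of block vectors is the sum of the inner products of the blocks; in particular $E[U^{n,j+1}]\le E[U^{n,1}]$. *)

(* Defs.v *)
From mathcomp Require Import all_boot all_order all_algebra.
From mathcomp Require Import all_classical all_reals all_analysis.

Set Implicit Arguments.
Unset Strict Implicit.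
Unset Printing Implicit Defensive.

Import Order.TTheory GRing.Theory Num.Theory.
Import numFieldNormedType.Exports.

Local Open Scope classical_set_scope.
Local Open Scope ring_scope.

Definition inner (R : realType) (m : nat) (u v : 'cV[R]_m) : R :=
  (v^T *m u) 0 0.

Definition sym_posdef (R : realType) (m : nat) (A : 'M[R]_m) : Prop :=
  A^T = A /\ forall v : 'cV[R]_m, v != 0 -> 0 < inner v (A *m v).

(* [B] is f(A), computed in an orthonormal eigenbasis of [A] (the columns of
   [Q]).  It does not depend on the choice of [Q], and such a [Q] exists
   exactly when [A] is symmetric. *)
Definition is_mxfun (R : realType) (m : nat) (f : R -> R) (A B : 'M[R]_m) :
    Prop :=
  exists (Q : 'M[R]_m) (d : 'rV[R]_m),
    [/\ Q^T *m Q = 1%:M,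
        A = Q *m diag_mx d *m Q^T
      & B = Q *m diag_mx (map_mx f d) *m Q^T].

(* f(A) for symmetric [A]; the value 0 is a dummy for non-symmetric [A]. *)
Definition mxfun (R : realType) (m : nat) (f : R -> R) (A : 'M[R]_m) :
    'M[R]_m :=
  xget 0 [set B | is_mxfun f A B].

Definition energy (R : realType) (M : nat) (Lh : 'M[R]_M) (G : R -> R)
    (u : 'cV[R]_M) : R :=
  2^-1 * inner u (Lh *m u) + inner (map_mx G u) (const_mx 1).

Definition Lkappa (R : realType) (M : nat) (Lh : 'M[R]_M) (kappa : R) :
    'M[R]_M :=
  Lh + kappa%:M.

Definition gkappa (R : realType) (M : nat) (g : R -> R) (kappa : R)
    (u : 'cV[R]_M) : 'cV[R]_M :=
  kappa *: u + map_mx g u.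

(* Stages are numbered from 1 as usual, so [U n 0] is unused, while matrix
   indices start at 0: the entry a_{i+1,j}, 1 <= j <= i <= s, of the scheme is
   [Ahat z (i-1) (j-1)]. *)
Definition is_scheme (R : realType) (M s : nat) (Ahat : R -> 'M[R]_s)
    (Lh : 'M[R]_M) (g : R -> R) (kappa tau : R)
    (u : nat -> 'cV[R]_M) (U : nat -> nat -> 'cV[R]_M) : Prop :=
  let L := Lkappa Lh kappa in
  forall n : nat, (1 <= n)%N ->
    [/\ U n 1%N = u n.-1,
        forall i : 'I_s,
          U n i.+2 = U n 1%N +
            \sum_(j < s | (j <= i)%N)
              mxfun (fun z => Ahat z i j) (- (tau *: L)) *m
                (tau *: gkappa g kappa (U n j.+1) - tau *: (L *m U n 1%N))
      & u n = U n s.+1].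

Definition ltri_ones (R : realType) (s : nat) : 'M[R]_s :=
  \matrix_(i < s, j < s) (j <= i)%N%:R.

Definition diff_mx (R : realType) (s : nat) (Ahat : R -> 'M[R]_s) (z : R) :
    'M[R]_s :=
  invmx (Ahat z) *m ltri_ones R s + z *: ltri_ones R s - (z / 2)%:M.

Definition lead_submx (R : realType) (s j : nat) (hj : (j <= s)%N)
    (A : 'M[R]_s) : 'M[R]_j :=
  mxsub (widen_ord hj) (widen_ord hj) A.

Definition block_fun (R : realType) (M j : nat) (D : R -> 'M[R]_j)
    (A : 'M[R]_M) : 'M[R]_(\sum_(k < j) M, \sum_(l < j) M) :=
  \mxblock_(k < j, l < j) mxfun (fun z => D z k l) A.

Definition stage_diffs (R : realType) (M : nat) (V : nat -> 'cV[R]_M)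
    (j : nat) : 'cV[R]_(\sum_(k < j) M) :=
  \mxcol_(k < j) (V k.+2 - V k.+1).

Lemma inner_mxcol (R : realType) (M j : nat) (v w : 'I_j -> 'cV[R]_M) :
  inner (\mxcol_(k < j) v k) (\mxcol_(k < j) w k) =
  \sum_(k < j) inner (v k) (w k).
Proof. by rewrite /inner tr_mxcol mul_mxrow_mxcol summxE. Qed.

Definition preserves_dissipation_law (R : realType) (M s : nat)
    (Ahat : R -> 'M[R]_s) (Lh : 'M[R]_M) (G g : R -> R) (kappa tau : R) :
    Prop :=
  forall (u : nat -> 'cV[R]_M) (U : nat -> nat -> 'cV[R]_M),
    is_scheme Ahat Lh g kappa tau u U ->
    forall (n j : nat) (hj : (j <= s)%N), (1 <= n)%N -> (1 <= j)%N ->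
      let Dj := block_fun (fun z => lead_submx hj (diff_mx Ahat z))
                  (- (tau *: Lkappa Lh kappa)) in
      let dU := stage_diffs (U n) j in
      energy Lh G (U n j.+1) - energy Lh G (U n 1%N)
        <= - tau^-1 * inner dU (Dj *m dU)
      /\ - tau^-1 * inner dU (Dj *m dU) <= 0.

Definition mx3 (R : realType) (rows : seq (seq R)) : 'M[R]_3 :=
  \matrix_(i < 3, j < 3) nth 0 (nth [::] rows i) j.

Definition TIF3_Heun (R : realType) (z : R) : 'M[R]_3 :=
  let q := expR (2 * z / 3) * (4 - z) - 3 * z in
  mx3 [:: [:: 1 / (3 - z);            0;                              0    ];
          [:: 0;                      2 / (3 * expR (z / 3) - 2 * z); 0    ];
          [:: expR (2 * z / 3) / q;   0;                              3 / q]].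

Definition NIF3_Heun (R : realType) (z : R) : 'M[R]_3 :=
  mx3 [:: [:: (expR (z / 3) - 1) / z; 0; 0];
          [:: 0; (expR (2 * z / 3) - 1) / z; 0];
          [:: expR z / 4; 0; (expR z - 1) / z - expR z / 4]].

(* Main.v *)
(* In an orthonormal eigenbasis of the symmetric matrix - tau L_kappa every
   block operator splits into s x s matrices evaluated at eigenvalues z < 0, and
   the scheme reads A(z)^-1 E_s dU = tau g_kappa(U) + z U^1.  Pair this with dU:
   one stage changes E by at most -1/tau times the corresponding block row of
   <dU, D dU> plus (lg - kappa/2) |dU|^2 <= 0, and summing over the stages gives
   the first inequality.  The second one says that the symmetric part of D(z)
   is positive semidefinite for z < 0; for both Heun schemes this is an explicit
   sum of squares in p = exp(z/3), valid because p (1 - z/3) <= 1. *)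

Require Import Defs.
From mathcomp Require Import all_boot all_order all_algebra.
From mathcomp Require Import all_classical all_reals all_analysis.
From mathcomp Require Import ring lra.
From mathcomp.real_closed Require complex.

Set Implicit Arguments.
Unset Strict Implicit.
Unset Printing Implicit Defensive.

Import Order.TTheory GRing.Theory Num.Theory.
Import numFieldNormedType.Exports.

Local Open Scope ring_scope.

(** * Orthogonal diagonalization of real symmetric matrices *)

Section SymmetricEigenvalue.
Import mathcomp.real_closed.complex.

(* The eigenvalue exists over [F[i]], and is real because [A] is hermitian. *)
Lemma symmetric_eigenvalue (F : rcfType) n (A : 'M[F]_n.+1) :
  A^T = A -> exists a, eigenvalue A a.
Proof.
move=> symA; pose C : numClosedFieldType := complex F.
pose toC : {rmorphism F -> C} := real_complex F.
pose Ac : 'M[C]_n.+1 := map_mx toC A.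
have hermA : Ac \is hermsymmx.
  apply/is_hermitianmxP; rewrite expr0 scale1r map_trmx -/Ac symA -map_mx_comp.
  by apply/matrixP => i j; rewrite !mxE /=; apply/esym/CrealP/complex_realP; eexists.
have /orthomx_spectralP specA := hermitian_normalmx hermA.
have /mxOverP/(_ 0 0)/complex_realP[a aE] :=
  hermitian_spectral_diag_real hermA.
(* The characteristic polynomial of [Ac] is the image of that of [A] under the injective [toC], so
   its real root [a] descends to [F]. *)
exists a; rewrite eigenvalue_root_char -(fmorph_root toC) map_char_poly.
rewrite -eigenvalue_root_char; apply/eigenvalueP.
exists (row 0 (spectralmx Ac)).
  rewrite -/Ac -row_mul [X in _ *m X]specA -mulmxA mulKVmx ?spectral_unit//.
  by apply/rowP => j; rewrite mul_diag_mx !mxE aE.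
(* A zero row of the invertible [spectralmx Ac] would make a row of the identity vanish. *)
apply/negP => /eqP row0; have := spectral_unit Ac.
rewrite -row_free_unit => /row_freeP[B /(congr1 (row 0))].
rewrite row_mul row0 mul0mx => /rowP/(_ 0); rewrite !mxE eqxx => /eqP.
by rewrite eq_sym oner_eq0.
Qed.

End SymmetricEigenvalue.

Lemma dot_ge0 (F : realFieldType) m (v : 'cV[F]_m) : 0 <= (v^T *m v) 0 0.
Proof. by rewrite mxE sumr_ge0// => i _; rewrite mxE -expr2 sqr_ge0. Qed.

Lemma dot_eq0 (F : realFieldType) m (v : 'cV[F]_m) :
  ((v^T *m v) 0 0 == 0) = (v == 0).
Proof.
apply/eqP/eqP => [|->]; last by rewrite mulmx0 mxE.
rewrite mxE => /eqP; rewrite psumr_eq0 => [/allP v0|i _]; last first.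
  by rewrite mxE -expr2 sqr_ge0.
apply/matrixP => i j; rewrite ord1 mxE; apply/eqP.
by have := v0 i (mem_index_enum _); rewrite mxE mulf_eq0 orbb.
Qed.

(** Take the reflection in the hyperplane orthogonal to [w = u - v]. Equal lengths give $\langle
    w,u\rangle=\langle w,w\rangle/2$, so it subtracts exactly [w] from [u]. *)
Lemma householder (F : realFieldType) m (u v : 'cV[F]_m) :
  (u^T *m u) 0 0 = (v^T *m v) 0 0 ->
  exists H : 'M[F]_m, [/\ H^T = H, H *m H = 1%:M & H *m u = v].
Proof.
move=> eq_uv; have [->|neq_uv] := eqVneq u v.
  by exists 1%:M; rewrite trmx1 !mul1mx.
pose w := u - v; pose s := (w^T *m w) 0 0.
have s_neq0 : s != 0 by rewrite dot_eq0 subr_eq0.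
have wwE : w^T *m w = s%:M by rewrite [LHS]mx11_scalar.
have dotC : (v^T *m u) 0 0 = (u^T *m v) 0 0.
  by rewrite !mxE; apply: eq_bigr => i _; rewrite !mxE mulrC.
have wu : w^T *m u = (s / 2)%:M.
  rewrite [LHS]mx11_scalar; congr (_%:M); rewrite /s /w linearB/=.
  have subE (B C : 'M[F]_1) : (B - C) 0 0 = B 0 0 - C 0 0 by rewrite !mxE.
  by rewrite !mulmxBl !mulmxBr !subE dotC -eq_uv; field.
exists (1%:M - (2 / s) *: (w *m w^T)); split.
- by rewrite linearB linearZ/= trmx1 trmx_mul trmxK.
- have PP : w *m w^T *m (w *m w^T) = s *: (w *m w^T).
    by rewrite mulmxA -[w *m w^T *m w]mulmxA wwE mul_mx_scalar -scalemxAl.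
  rewrite mulmxBl mul1mx !mulmxBr mulmx1 -!scalemxAl -!scalemxAr PP !scalerA.
  have -> : 2 / s * (2 / s) * s = 2 / s + 2 / s by field.
  by rewrite scalerDl opprB addrK subrK.
- rewrite mulmxBl mul1mx -scalemxAl -mulmxA wu mul_mx_scalar scalerA.
  by rewrite mulrA mulfVK// mulfV ?pnatr_eq0// scale1r /w opprB addrC subrK.
Qed.

(* Deflation: a reflection moves a unit eigenvector to the first basis vector. *)
Theorem symmetric_orthodiag (F : rcfType) n (A : 'M[F]_n) : A^T = A ->
  exists (Q : 'M[F]_n) (d : 'rV[F]_n),
    Q^T *m Q = 1%:M /\ A = Q *m diag_mx d *m Q^T.
Proof.
elim: n => [|n IHn] in A *; first by exists 1%:M, 0; split; apply/matrixP => -[].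
move=> symA; have [a /eigenvalueP[v vA v_neq0]] := symmetric_eigenvalue symA.
pose e : 'cV[F]_n.+1 := delta_mx 0 0.
have ee : (e^T *m e) 0 0 = 1.
  by rewrite trmx_delta mul_delta_mx mxE !eqxx.
pose s := (v *m v^T) 0 0.
have s_gt0 : 0 < s.
  rewrite lt_neqAle eq_sym /s -[v in v *m _]trmxK dot_eq0 trmx_eq0 v_neq0.
  exact: dot_ge0.
pose u := (Num.sqrt s)^-1 *: v^T.
have Au : A *m u = a *: u.
  by rewrite -symA -scalemxAr -trmx_mul vA linearZ/= !scalerA mulrC.
have [|H [symH HH He]] := @householder F _ e u.
  rewrite ee /u [(_ *: _)^T]linearZ/= trmxK -scalemxAl -scalemxAr scalerA mxE -/s.
  by rewrite -invfM -expr2 sqr_sqrtr ?ltW// mulVf ?gt_eqF.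
(* The type [1 + n] makes the block operations applicable to the conjugate of [A]. As [H] exchanges
   [e] and [u], its first column is [a *: e], and symmetry then clears the first row. *)
have [B BD] : exists B : 'M[F]_(1 + n), B = H *m A *m H by eexists.
have symB : B^T = B by rewrite BD !trmx_mul symH symA mulmxA.
have colB : H *m A *m H *m e = a *: e.
  by rewrite -mulmxA He -mulmxA Au -scalemxAr -He mulmxA HH mul1mx.
have B0 i : B i (lshift n 0) = a * (i == lshift n 0)%:R.
  by rewrite BD !lshift0; have /colP/(_ i) := colB; rewrite /e -colE !mxE eqxx andbT.
have BE : B = block_mx a%:M 0 0 (drsubmx B).
  have dl0 : dlsubmx B = 0.
    by apply/matrixP => i j; rewrite ord1 !mxE B0 mulr0.
  rewrite -[LHS]submxK dl0; congr block_mx; last first.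
    by rewrite -[ursubmx B]trmxK trmx_ursub symB dl0 trmx0.
  apply/matrixP => i j; rewrite !ord1 !mxE B0 eqxx mulr1.
  by rewrite mulr1n.
have [|Q [d [QQ drE]]] := IHn (drsubmx B); first by rewrite trmx_drsub symB.
pose K : 'M[F]_(1 + n) := block_mx 1%:M 0 0 Q.
have KK : K^T *m K = 1%:M.
  rewrite tr_block_mx !trmx0 trmx1 mulmx_block !mulmx0 !mul0mx !addr0 add0r.
  by rewrite mulmx1 QQ -scalar_mx_block.
have BK : B = K *m diag_mx (row_mx a%:M d) *m K^T.
  rewrite BE drE diag_mx_row tr_block_mx !trmx0 trmx1 !mulmx_block.
  rewrite !(mulmx0, mul0mx, addr0, add0r, mul1mx, mulmx1).
  by congr block_mx; apply/matrixP => i j; rewrite !ord1 !mxE eqxx.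
exists (H *m K), (row_mx a%:M d); split.
  by rewrite trmx_mul symH mulmxA -[K^T *m H *m H]mulmxA HH mulmx1.
have -> : A = H *m B *m H.
  by rewrite BD !mulmxA HH mul1mx -mulmxA HH mulmx1.
by rewrite trmx_mul symH BK !mulmxA.
Qed.

(** * Matrix functions in an eigenbasis *)

(** Entrywise, the hypothesis forces $e_j=d_i$ wherever $P_{ij}\ne0$, and $f$ preserves this
    equality. *)
Lemma diag_mx_intertwine (F : fieldType) m n (f : F -> F) (P : 'M[F]_(m, n))
    (d : 'rV[F]_m) (e : 'rV[F]_n) :
  P *m diag_mx e = diag_mx d *m P ->
  P *m diag_mx (map_mx f e) = diag_mx (map_mx f d) *m P.
Proof.
move=> /matrixP Pde; apply/matrixP => i j; have := Pde i j.
rewrite !mul_mx_diag !mul_diag_mx !mxE.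
have [->|Pij_neq0] := eqVneq (P i j) 0; first by rewrite !mul0r !mulr0.
by rewrite mulrC => /(mulIf Pij_neq0) ->; rewrite mulrC.
Qed.

(** Any two orthogonal diagonalizations of [A] are related by [P = Q1^T *m Q], which intertwines
    their diagonals. Hence the basis picked by [xget] does not matter, and its default value is
    never taken. *)
Lemma mxfunE (R : realType) m (f : R -> R) (A Q : 'M[R]_m) (d : 'rV[R]_m) :
  Q^T *m Q = 1%:M -> A = Q *m diag_mx d *m Q^T ->
  mxfun f A = Q *m diag_mx (map_mx f d) *m Q^T.
Proof.
move=> QQ AE; have QQ' := mulmx1C QQ; rewrite /mxfun.
have [|Q1 [d1 [QQ1 AE1 ->]]] := @xgetPex _ 0 [set B | is_mxfun f A B]%classic.
  by exists (Q *m diag_mx (map_mx f d) *m Q^T), Q, d.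
have QQ1' := mulmx1C QQ1.
pose P := Q1^T *m Q.
have Pd : P *m diag_mx d = diag_mx d1 *m P.
  have <- : Q1^T *m A *m Q = P *m diag_mx d.
    by rewrite AE !mulmxA -[_ *m Q^T *m Q]mulmxA QQ mulmx1.
  by rewrite AE1 !mulmxA QQ1 mul1mx.
have Pfd := diag_mx_intertwine f Pd.
have Q1P : Q1 *m P = Q by rewrite mulmxA QQ1' mul1mx.
have PQ : P *m Q^T = Q1^T by rewrite -mulmxA QQ' mulmx1.
by rewrite -PQ mulmxA -(mulmxA Q1) -Pfd mulmxA Q1P.
Qed.

(** * Inner products in orthonormal coordinates *)

Section InnerLinear.
Context {R : realType} {m : nat}.
Implicit Types (u v w : 'cV[R]_m) (a : R).

Lemma innerC u v : inner u v = inner v u.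
Proof. by rewrite /inner !mxE; apply: eq_bigr => i _; rewrite !mxE mulrC. Qed.

Lemma innerDr u v w : inner u (v + w) = inner u v + inner u w.
Proof. by rewrite innerC ![inner u _]innerC /inner mulmxDr mxE. Qed.

Lemma innerZr a u v : inner u (a *: v) = a * inner u v.
Proof. by rewrite innerC [inner u v]innerC /inner -scalemxAr mxE. Qed.

Lemma inner_sumr (I : Type) (r : seq I) (P : pred I) (F : I -> 'cV[R]_m) u :
  inner u (\sum_(i <- r | P i) F i) = \sum_(i <- r | P i) inner u (F i).
Proof.
elim/big_rec2: _ => [|i x v _ <-]; last exact: innerDr.
by rewrite -(scale0r 0) innerZr mul0r.
Qed.

End InnerLinear.

Lemma inner_diag (R : realType) m (Q : 'M[R]_m) (d : 'rV[R]_m)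
    (u v : 'cV[R]_m) :
  inner u (Q *m diag_mx d *m Q^T *m v) =
  \sum_i d 0 i * (Q^T *m u) i 0 * (Q^T *m v) i 0.
Proof.
rewrite innerC /inner !mulmxA -[u^T *m Q]trmxK trmx_mul trmxK.
rewrite -[_ *m Q^T *m v]mulmxA mxE; apply: eq_bigr => i _.
by rewrite mul_mx_diag mxE [in LHS]mxE [_ * d _ _]mulrC.
Qed.

Lemma inner_orth (R : realType) m (Q : 'M[R]_m) (u v : 'cV[R]_m) :
  Q^T *m Q = 1%:M ->
  inner u v = \sum_i (Q^T *m u) i 0 * (Q^T *m v) i 0.
Proof.
move=> /mulmx1C QQ; have := inner_diag Q (const_mx 1) u v.
rewrite diag_const_mx mulmx1 QQ mul1mx => ->.
by apply: eq_bigr => i _; rewrite mxE mul1r.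
Qed.

(** * Lower triangular matrices *)

Lemma trigmx_mul (R : pzRingType) s (A B : 'M[R]_s) :
  is_trig_mx A -> is_trig_mx B -> is_trig_mx (A *m B).
Proof.
move=> /is_trig_mxP trigA /is_trig_mxP trigB; apply/is_trig_mxP => i j ltij.
rewrite mxE big1// => k _; have [ltik|leki] := ltnP i k.
  by rewrite trigA// mul0r.
by rewrite trigB ?mulr0// (leq_ltn_trans leki).
Qed.

(** Forward substitution, by strong induction on the row: in entry $(i,j)$ of $AA^{-1}=I$ with
    $i<j$, only the term with the nonzero pivot $A_{ii}$ survives. *)
Lemma trigmx_inv (F : fieldType) s (A : 'M[F]_s) :
  is_trig_mx A -> A \in unitmx -> is_trig_mx (invmx A).
Proof.
move=> trigA unitA; have := unitA.
rewrite unitmxE det_trig// unitfE => /prodf_neq0 diagA.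
move/is_trig_mxP in trigA; apply/is_trig_mxP => i j.
have [k] := ubnP (val i); elim: k => // k IHk in i *; rewrite ltnS => leik ltij.
have /matrixP/(_ i j) := mulmxV unitA.
rewrite !mxE [_ == _]ltn_eqF// (bigD1 i)//= big1 ?addr0 => [|l neq_li].
  by move=> /eqP; rewrite mulf_eq0 (negPf (diagA i isT)) => /eqP.
have [ltil|] := ltnP i l; first by rewrite trigA// mul0r.
rewrite leq_eqVlt [_ == _](negPf neq_li)/= => ltli.
by rewrite (IHk l (leq_trans ltli leik) (ltn_trans ltli ltij)) mulr0.
Qed.

Lemma diff_mx_trig (R : realType) s (Ahat : R -> 'M[R]_s) z :
  is_trig_mx (Ahat z) -> Ahat z \in unitmx -> is_trig_mx (diff_mx Ahat z).
Proof.
move=> trigA unitA.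
have trigE : is_trig_mx (ltri_ones R s).
  by apply/is_trig_mxP => i j ltij; rewrite mxE leqNgt ltij.
have /is_trig_mxP trigAE := trigmx_mul (trigmx_inv trigA unitA) trigE.
have /is_trig_mxP trigI : is_trig_mx (- (z / 2)%:M : 'M[R]_s).
  by rewrite -raddfN scalar_mx_is_trig.
move/is_trig_mxP in trigE; apply/is_trig_mxP => i j ltij.
rewrite /diff_mx [LHS]mxE [X in X + _]mxE [(z *: ltri_ones R s) i j]mxE.
by rewrite trigAE ?trigE ?trigI// mulr0 !addr0.
Qed.

(** * Energy change over one stage *)

(* Comparing with the tangent costs [lg] instead of the sharp [lg / 2]; this is
   what [2 * lg <= kappa] pays for. *)
Lemma lipschitz_derive_le (R : realType) (G g : R -> R) (lg x y : R) :
  (forall x : R, derivable G x 1) -> (forall x : R, g x = - derive1 G x) ->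
  lg.-lipschitz g ->
  G y - G x <= - g x * (y - x) + lg * (y - x) ^+ 2.
Proof.
move=> dG gE lipg.
have Gd (t : R) : is_derive t 1 G (- g t).
  by rewrite gE opprK derive1E; apply: derivableP.
have Gc : continuous G.
  by move=> t; apply: differentiable_continuous; apply/derivable1_diffP.
have Glip a b : `|g a - g b| <= lg * `|a - b| by exact: (lipg (a, b)).
have lg_ge0 : 0 <= lg.
  by have := Glip 1 0; rewrite subr0 normr1 mulr1; apply: le_trans.
(* The mean value theorem needs ordered endpoints, hence two cases. Only the distance of [c] from
   [x] is kept, to feed the Lipschitz bound. *)
have [c cxy ->] : exists2 c, `|x - c| <= `|y - x| & G y - G x = - g c * (y - x).
  have [lexy|/ltW leyx] := leP x y.
    have [c /andP[]] := MVT_segment lexy (fun t _ => Gd t)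
      (continuous_subspaceT Gc).
    rewrite !bnd_simp => lexc lecy GE; exists c => //.
    by rewrite distrC !ger0_norm ?subr_ge0// lerD2r.
  have [c /andP[]] := MVT_segment leyx (fun t _ => Gd t)
    (continuous_subspaceT Gc).
  rewrite !bnd_simp => leyc lecx GE; exists c; last by lra.
  by rewrite [leRHS]distrC !ger0_norm ?subr_ge0// lerD2l lerN2.
have -> : - g c * (y - x) = - g x * (y - x) + (g x - g c) * (y - x) by ring.
rewrite lerD2l (le_trans (ler_norm _))// normrM -[_ ^+ 2]real_normK ?num_real//.
rewrite expr2 mulrA ler_wpM2r// (le_trans (Glip _ _))//.
exact: ler_wpM2l.
Qed.

(** With $e=y-x$, symmetry turns the quadratic part into $\frac12\langle y+x,L_he\rangle$. The two
    $\kappa$-terms on the right add up to $\frac\kappa2|e|^2$, which absorbs the Lipschitz error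
    $\ell_g|e|^2$. *)
Lemma energy_step (R : realType) M (Lh : 'M[R]_M) (G g : R -> R)
    (lg kappa : R) (x y : 'cV[R]_M) :
  Lh^T = Lh -> (forall x : R, derivable G x 1) ->
  (forall x : R, g x = - derive1 G x) -> lg.-lipschitz g -> 2 * lg <= kappa ->
  energy Lh G y - energy Lh G x <=
    2^-1 * inner (y + x) (Lkappa Lh kappa *m (y - x)) -
    inner (gkappa g kappa x) (y - x).
Proof.
move=> symL dG gE lipg le_kappa; pose e := y - x.
have yE : y = x + e by rewrite addrC subrK.
have xLe : inner x (Lh *m e) = inner e (Lh *m x).
  by rewrite [RHS]innerC /inner trmx_mul symL mulmxA.
have Gstep : inner (map_mx G y) (const_mx 1) - inner (map_mx G x) (const_mx 1)
    <= - inner (map_mx g x) e + lg * inner e e.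
  rewrite /inner !mxE mulr_sumr -!sumrN -!big_split/=.
  apply: ler_sum => i _; rewrite !mxE !mul1r.
  have := lipschitz_derive_le (x i 0) (y i 0) dG gE lipg.
  by rewrite expr2; nra.
have ee_ge0 : 0 <= inner e e by rewrite /inner dot_ge0.
have innerDl (u v w : 'cV[R]_M) : inner (u + v) w = inner u w + inner v w.
  by rewrite innerC innerDr ![inner w _]innerC.
move: Gstep; rewrite -/e; clearbody e; rewrite yE /energy /gkappa /Lkappa.
rewrite mulmxDl mul_scalar_mx mulmxDr !(innerDl, innerDr, innerZr).
rewrite [inner (kappa *: x) e]innerC innerZr [inner e x]innerC xLe => Gstep.
have : 2 * lg * inner e e <= kappa * inner e e by rewrite ler_wpM2r.
lra.
Qed.

(** * Block quadratic forms and their leading parts *)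

(** All blocks are functions of the same [A], so [Q] diagonalizes them simultaneously. Regrouping by
    eigenvalue index [m] instead of by stage decouples the form. *)
Lemma inner_block_fun (R : realType) M j (D : R -> 'M[R]_j)
    (A Q : 'M[R]_M) (d : 'rV[R]_M) (V : nat -> 'cV[R]_M) :
  Q^T *m Q = 1%:M -> A = Q *m diag_mx d *m Q^T ->
  let dU := stage_diffs V j in
  let c m := \col_(k < j) (Q^T *m (V k.+2 - V k.+1)) m 0 in
  inner dU (block_fun D A *m dU) =
  \sum_m ((c m)^T *m D (d 0 m) *m c m) 0 0.
Proof.
move=> QQ AE /=; rewrite /stage_diffs /block_fun mul_mxblock_mxrow inner_mxcol.
under [LHS]eq_bigr => k _.
  rewrite inner_sumr.
  under eq_bigr => l _ do rewrite (mxfunE _ QQ AE) inner_diag.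
  rewrite exchange_big /=.
  over.
rewrite exchange_big /=; apply: eq_bigr => m _; rewrite [RHS]mxE exchange_big /=.
apply: eq_bigr => l _; rewrite [X in _ = X * _]mxE mulr_suml.
apply: eq_bigr => k _.
by rewrite !mxE; ring.
Qed.

(** Pad [x] with zeros: [E^T] embeds the first [j] coordinates, and compressing [D] by [E] gives the
    leading submatrix. *)
Lemma lead_submx_quad_ge0 (R : realType) s j (hj : (j <= s)%N) (D : 'M[R]_s)
    (x : 'cV[R]_j) :
  (forall y : 'cV[R]_s, 0 <= (y^T *m D *m y) 0 0) ->
  0 <= (x^T *m lead_submx hj D *m x) 0 0.
Proof.
move=> D_ge0; pose E : 'M[R]_(j, s) := \matrix_(k, l) (l == widen_ord hj k)%:R.
have <- : E *m D *m E^T = lead_submx hj D.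
  apply/matrixP => k l; rewrite !mxE (bigD1 (widen_ord hj l))//= big1.
    rewrite !mxE eqxx mulr1 addr0 (bigD1 (widen_ord hj k))//= big1 ?addr0.
      by rewrite mxE eqxx mul1r.
    by move=> i /negPf ne; rewrite mxE ne mul0r.
  by move=> i /negPf ne; rewrite !mxE ne mulr0.
by have := D_ge0 (E^T *m x); rewrite trmx_mul trmxK !mulmxA.
Qed.

(** The first [j] rows of a lower triangular matrix vanish beyond column [j], so truncating [x]
    loses nothing. This lets one computation with all [s] stages serve every [j]. *)
Lemma lead_submx_mul (R : realType) s j (hj : (j <= s)%N) (D : 'M[R]_s)
    (x : 'cV[R]_s) (k : 'I_j) :
  is_trig_mx D ->
  (lead_submx hj D *m rowsub (widen_ord hj) x) k 0 =
  (D *m x) (widen_ord hj k) 0.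
Proof.
move=> /is_trig_mxP trigD; rewrite !mxE.
rewrite [RHS](bigID (fun l : 'I_s => (l < j)%N))/= [X in _ + X]big1 ?addr0.
  by rewrite big_ord_narrow; apply: eq_bigr => l _; rewrite !mxE.
move=> l; rewrite -leqNgt => lejl.
by rewrite trigD ?mul0r//= (leq_trans (ltn_ord k)).
Qed.

Lemma diag_posdef_gt0 (R : realType) M (A Q : 'M[R]_M) (d : 'rV[R]_M) :
  Q^T *m Q = 1%:M -> A = Q *m diag_mx d *m Q^T ->
  (forall v : 'cV[R]_M, v != 0 -> 0 < inner v (A *m v)) ->
  forall m, 0 < d 0 m.
Proof.
move=> QQ AE posA m; pose v := Q *m (delta_mx m 0 : 'cV_M).
have Qv : Q^T *m v = delta_mx m 0 by rewrite mulmxA QQ mul1mx.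
have v_neq0 : v != 0.
  apply/eqP => v0; have /colP/(_ m) := Qv.
  by rewrite v0 mulmx0 !mxE !eqxx => /eqP; rewrite eq_sym oner_eq0.
have := posA v v_neq0; rewrite AE inner_diag Qv (bigD1 m)//= big1 ?addr0.
  by rewrite !mxE !eqxx !mulr1.
by move=> i /negPf ne; rewrite !mxE ne mulr0.
Qed.

(** * From scalar positivity of $D(z)$ to energy dissipation *)

(** Separates what depends on the scheme, namely three scalar facts for [z < 0], from the energy
    argument, which holds for any number of stages. *)
Theorem dissipation_criterion (R : realType) M s (Ahat : R -> 'M[R]_s)
    (Lh : 'M[R]_M) (G g : R -> R) (lg kappa tau : R) :
  sym_posdef Lh -> (forall x : R, derivable G x 1) ->
  (forall x : R, g x = - derive1 G x) -> 0 < lg -> lg.-lipschitz g ->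
  2 * lg <= kappa -> 0 < tau ->
  (forall z, z < 0 -> is_trig_mx (Ahat z)) ->
  (forall z, z < 0 -> Ahat z \in unitmx) ->
  (forall z, z < 0 -> forall x : 'cV[R]_s,
     0 <= (x^T *m diff_mx Ahat z *m x) 0 0) ->
  preserves_dissipation_law Ahat Lh G g kappa tau.
Proof.
move=> [symL posL] dG gE lg_gt0 lipg le_kappa tau_gt0 trigA unitA D_ge0.
move=> u U sch n j hj n_gt0 _ /=.
have [_ stageE _] := sch n n_gt0.
pose L := Lkappa Lh kappa.
have [Q [d0 [QQ LhE]]] := symmetric_orthodiag symL.
have QQ' := mulmx1C QQ.
have [d [d_lt0 ZE]] : exists d : 'rV[R]_M,
    (forall m, d 0 m < 0) /\ - (tau *: L) = Q *m diag_mx d *m Q^T.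
  exists (\row_m (- (tau * (d0 0 m + kappa)))); split=> [m|].
    have := diag_posdef_gt0 QQ LhE posL m; rewrite mxE oppr_lt0 => d0_gt0.
    by rewrite mulr_gt0//; lra.
  transitivity (Q *m (- (tau *: (diag_mx d0 + kappa%:M))) *m Q^T).
    rewrite mulmxN mulNmx -scalemxAr -scalemxAl mulmxDr mulmxDl -LhE.
    by rewrite mul_mx_scalar -scalemxAl QQ' scalemx1.
  congr (_ *m _ *m _); apply/matrixP => a b; rewrite !mxE.
  by case: eqP => _; rewrite ?mulr1n// !mulr0n addr0 mulr0 oppr0.
(* In mode [m], [c] and [f] are the coordinates of a stage and of its nonlinear term, [dl] collects
   the increments and [F] the bracket of the scheme. Row [k], counted from 0, produces stage
   [k.+2]. *)
pose c k m := (Q^T *m U n k) m 0.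
pose f k m := (Q^T *m gkappa g kappa (U n k)) m 0.
have cB k l m : (Q^T *m (U n k - U n l)) m 0 = c k m - c l m.
  by rewrite mulmxBr mxE [X in _ + X]mxE.
have cD k l m : (Q^T *m (U n k + U n l)) m 0 = c k m + c l m.
  by rewrite mulmxDr mxE.
pose dl m : 'cV[R]_s := \col_(k < s) (c k.+2 m - c k.+1 m).
pose F m : 'cV[R]_s := \col_(k < s) (tau * f k.+1 m + d 0 m * c 1%N m).
have EdlE m (k : 'I_s) : (ltri_ones R s *m dl m) k 0 = c k.+2 m - c 1%N m.
  rewrite mxE -(telescope_sumr (fun k => c k.+1 m) (leq0n k.+1)) big_mkord.
  transitivity (\sum_(l < s | (l < k.+1)%N) (c l.+2 m - c l.+1 m)); last first.
    by rewrite (big_ord_narrow (ltn_ord k)).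
  rewrite [RHS]big_mkcond/=; apply: eq_bigr => l _.
  by rewrite !mxE ltnS; case: ifP => _; rewrite ?mul1r ?mul0r.
(* The scheme in mode [m]. Triangularity of [Ahat] extends its restricted sum over [j <= i] to a
   full matrix product. *)
have AFE m : Ahat (d 0 m) *m F m = ltri_ones R s *m dl m.
  apply/colP => k; rewrite EdlE /c stageE mulmxDr [X in X - _]mxE [RHS]addrC addKr.
  rewrite mulmx_sumr summxE mxE [LHS](bigID (fun l : 'I_s => (l <= k)%N))/=.
  rewrite [X in _ + X]big1 ?addr0 => [|l]; last first.
    rewrite -ltnNge => ltkl.
    by have /is_trig_mxP-> := trigA _ (d_lt0 m); rewrite ?mul0r.
  apply: eq_bigr => l _; rewrite (mxfunE _ QQ ZE) !mulmxA QQ mul1mx.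
  rewrite -!mulmxA mul_diag_mx [RHS]mxE [X in _ = X * _]mxE.
  congr (_ * _); rewrite mxE mulmxBr -/(Lkappa Lh kappa) -/L.
  have -> : tau *: (L *m U n 1%N) = - (- (tau *: L) *m U n 1%N).
    by rewrite mulNmx opprK -scalemxAl.
  rewrite ZE mulmxN opprK !mulmxA QQ mul1mx -mulmxA mul_diag_mx.
  by rewrite -scalemxAr [RHS]mxE [X in _ = X + _]mxE [X in _ = _ + X]mxE.
(* The term $-\frac z2I$ of $D$ leaves $z$ times the average of two consecutive stages, matching the
   factor $\frac12(y+x)$ in [energy_step]. *)
have DdlE m (k : 'I_s) : (diff_mx Ahat (d 0 m) *m dl m) k 0 =
    tau * f k.+1 m + d 0 m * c k.+1 m + d 0 m / 2 * (c k.+2 m - c k.+1 m).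
  have -> : diff_mx Ahat (d 0 m) *m dl m =
      F m + d 0 m *: (ltri_ones R s *m dl m) - (d 0 m / 2) *: dl m.
    rewrite /diff_mx mulmxBl mulmxDl mul_scalar_mx -scalemxAl -mulmxA -AFE.
    by rewrite mulKmx// unitA.
  rewrite mxE [X in X + _]mxE [X in _ + X + _]mxE EdlE.
  rewrite [X in _ + X]mxE [X in _ - X]mxE !mxE.
  by field.
have energyE (k : 'I_s) : energy Lh G (U n k.+2) - energy Lh G (U n k.+1) <=
    - tau^-1 * \sum_m dl m k 0 * (diff_mx Ahat (d 0 m) *m dl m) k 0.
  apply: le_trans (energy_step _ _ symL dG gE lipg le_kappa) _.
  have -> : Lkappa Lh kappa = - tau^-1 *: - (tau *: L).
    by rewrite scaleNr scalerN opprK scalerA mulVf ?scale1r// gt_eqF.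
  rewrite -scalemxAl innerZr ZE inner_diag (inner_orth _ _ QQ).
  rewrite !mulr_sumr -sumrB; apply: ler_sum => m _.
  (* The only loss is in [energy_step]; what remains is an identity in each mode. *)
  rewrite le_eqVlt; apply/predU1P; left; rewrite DdlE cB cD [dl m k 0]mxE -/(f _ _).
  by field; rewrite gt_eqF.
have quadE : inner (stage_diffs (U n) j)
    (block_fun (fun z => lead_submx hj (diff_mx Ahat z)) (- (tau *: L))
      *m stage_diffs (U n) j) =
  \sum_(k < j) \sum_m dl m (widen_ord hj k) 0 *
    (diff_mx Ahat (d 0 m) *m dl m) (widen_ord hj k) 0.
  rewrite (inner_block_fun _ _ QQ ZE) [RHS]exchange_big; apply: eq_bigr => m _ /=.
  rewrite -mulmxA mxE; apply: eq_bigr => k _.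
  rewrite (_ : \col_k _ = rowsub (widen_ord hj) (dl m)); last first.
    by apply/colP => l; rewrite [LHS]mxE cB 2![RHS]mxE.
  by rewrite lead_submx_mul ?diff_mx_trig ?trigA ?unitA// 2![X in X * _]mxE.
split.
  rewrite quadE.
  have -> : energy Lh G (U n j.+1) - energy Lh G (U n 1%N) =
     \sum_(k < j) (energy Lh G (U n k.+2) - energy Lh G (U n k.+1)).
    rewrite -(telescope_sumr (fun k => energy Lh G (U n k.+1)) (leq0n j)).
    by rewrite big_mkord.
  by rewrite mulr_sumr ler_sum// => k _; exact: energyE (widen_ord hj k).
rewrite mulNr oppr_le0 mulr_ge0//; first by rewrite invr_ge0 ltW.
rewrite (inner_block_fun _ _ QQ ZE) sumr_ge0// => m _.
exact/lead_submx_quad_ge0/D_ge0.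
Qed.

(** * Coefficient matrices of Heun type *)

(** The zero pattern common to both schemes, stable under inversion. *)
Definition heun_mx (R : realType) (a b c d : R) : 'M[R]_3 :=
  mx3 [:: [:: a; 0; 0]; [:: 0; b; 0]; [:: c; 0; d]].

Lemma heun_trig (R : realType) (a b c d : R) : is_trig_mx (heun_mx a b c d).
Proof.
by apply/is_trig_mxP => -[[|[|[|//]]] ?] [[|[|[|//]]] ?] //= _; rewrite mxE.
Qed.

Lemma heun_mulV (R : realType) (a b c d : R) :
  a != 0 -> b != 0 -> d != 0 ->
  heun_mx a b c d *m heun_mx a^-1 b^-1 (- c / (a * d)) d^-1 = 1%:M.
Proof.
move=> a0 b0 d0; apply/matrixP => i j.
rewrite mxE !big_ord_recl big_ord0 !mxE /=.
by case: i => [[|[|[|//]]] ?]; case: j => [[|[|[|//]]] ?] /=;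
   rewrite ?mulr1n ?mulr0n; field; rewrite ?a0 ?b0 ?d0.
Qed.

Lemma heun_unit (R : realType) (a b c d : R) :
  a != 0 -> b != 0 -> d != 0 -> heun_mx a b c d \in unitmx.
Proof. by move=> a0 b0 d0; have /mulmx1_unit[] := heun_mulV c a0 b0 d0. Qed.

Lemma heun_inv (R : realType) (a b c d : R) :
  a != 0 -> b != 0 -> d != 0 ->
  invmx (heun_mx a b c d) = heun_mx a^-1 b^-1 (- c / (a * d)) d^-1.
Proof.
move=> a0 b0 d0; rewrite -[LHS]mulmx1 -(heun_mulV c a0 b0 d0).
by rewrite mulKmx ?heun_unit.
Qed.

(** The off-diagonal entry of the inverse meets only the first row $(1,0,0)$ of $E_s$, so [c]
    affects the $x_1x_3$ coefficient alone. *)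
Lemma heun_quad (R : realType) (Ahat : R -> 'M[R]_3) (a b c d z : R)
    (x : 'cV[R]_3) :
  Ahat z = heun_mx a b c d -> a != 0 -> b != 0 -> d != 0 ->
  let x1 := x 0 0 in let x2 := x 1 0 in let x3 := x 2%:R 0 in
  (x^T *m diff_mx Ahat z *m x) 0 0 =
  (a^-1 + z / 2) * x1 ^+ 2 + (b^-1 + z) * x1 * x2 + (b^-1 + z / 2) * x2 ^+ 2 +
  (d^-1 - c / (a * d) + z) * x1 * x3 + (d^-1 + z) * x2 * x3 +
  (d^-1 + z / 2) * x3 ^+ 2.
Proof.
move=> AE a0 b0 d0 x1 x2 x3; rewrite /diff_mx AE heun_inv//.
rewrite !(mxE, big_ord_recl, big_ord0) /=.
have -> : x ord0 0 = x1 by [].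
have -> : x (lift ord0 ord0) 0 = x2 by congr (x _ _); exact: val_inj.
have -> : x (lift ord0 (lift ord0 ord0)) 0 = x3 by congr (x _ _); exact: val_inj.
by rewrite !mulr1n !mulr0n; field; rewrite a0 b0 d0.
Qed.

(** * Positivity of the two quadratic forms *)

Lemma expR_mul1B_le1 (R : realType) (t : R) : expR t * (1 - t) <= 1.
Proof.
rewrite -[leRHS](mulfV (lt0r_neq0 (expR_gt0 t))) ler_pM2l ?expR_gt0//.
by rewrite -expRN expR_ge1Dx.
Qed.

(** Here $p=e^{z/3}$, $y=-z$ and $s=p^2(4-z)/3$. *)
Lemma tif3_form_ge0 (R : realFieldType) (p s y x1 x2 x3 : R) :
  0 <= p <= 1 -> 0 <= y -> 4 / 3 * p ^+ 2 <= s <= 4 / 3 * p ->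
  0 <= (3 + y / 2) * x1 ^+ 2 + 3 / 2 * p * x1 * x2 +
       (3 / 2 * p + y / 2) * x2 ^+ 2 + p ^+ 2 / 3 * x1 * x3 + s * x2 * x3 +
       (s + y / 2) * x3 ^+ 2.
Proof.
move=> /andP[p_ge0 p_le1] y_ge0 /andP[s_ge s_le].
(* The square of $x_2+x_3$ absorbs the $s$ cross term. The bounds on $s$ leave at least
   $\frac56p\,x_2^2$ and $\frac23p^2x_3^2$, enough to complete squares with $x_1$; the last
   coefficient is positive since $p\le1$. *)
have -> : (3 + y / 2) * x1 ^+ 2 + 3 / 2 * p * x1 * x2 +
       (3 / 2 * p + y / 2) * x2 ^+ 2 + p ^+ 2 / 3 * x1 * x3 + s * x2 * x3 +
       (s + y / 2) * x3 ^+ 2 =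
    y / 2 * (x1 ^+ 2 + x2 ^+ 2 + x3 ^+ 2) + s / 2 * (x2 + x3) ^+ 2 +
    (2 / 3 * p - s / 2) * x2 ^+ 2 + (s / 2 - 2 / 3 * p ^+ 2) * x3 ^+ 2 +
    5 / 6 * p * (x2 + 9 / 10 * x1) ^+ 2 + 2 / 3 * p ^+ 2 * (x3 + x1 / 4) ^+ 2 +
    (3 - 27 / 40 * p - p ^+ 2 / 24) * x1 ^+ 2 by field.
have pp_ge0 : 0 <= p ^+ 2 := sqr_ge0 p.
have pp_le1 : p ^+ 2 <= 1 by rewrite exprn_ile1.
by do 6?[apply: addr_ge0]; apply: mulr_ge0; rewrite ?sqr_ge0//;
  by [lra | rewrite !addr_ge0 ?sqr_ge0].
Qed.

(** The NIF3 form divided by $-z/2$, with $p=e^{z/3}$ and $m=p^3(1-z/4)$; [t] carries the coupling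
    of the first and third increments. Completing the squares of $x_2+x_3$, $x_1+x_2$ and $x_3+tx_1$
    leaves nonnegative multiples of $x_1^2$ and $x_2^2$. *)
Lemma nif3_form_ge0 (R : realFieldType) (p m t x1 x2 x3 : R) :
  0 <= p < 1 -> 0 <= m <= p ^+ 2 -> t ^+ 2 <= 1 ->
  0 <= (1 + p) / (1 - p) * x1 ^+ 2 + 2 * p ^+ 2 / (1 - p ^+ 2) * x1 * x2 +
       (1 + p ^+ 2) / (1 - p ^+ 2) * x2 ^+ 2 + 2 * t / (1 - m) * x1 * x3 +
       2 * m / (1 - m) * x2 * x3 + (1 + m) / (1 - m) * x3 ^+ 2.
Proof.
move=> /andP[p_ge0 p_lt1] /andP[m_ge0 m_le] t_le1.
have pp_lt1 : p ^+ 2 < 1 by rewrite exprn_ilt1.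
have A_gt0 : 0 < 1 - p ^+ 2 by rewrite subr_gt0.
have B_gt0 : 0 < 1 - m by lra.
have p'_gt0 : 0 < 1 - p by lra.
have -> : (1 + p) / (1 - p) * x1 ^+ 2 + 2 * p ^+ 2 / (1 - p ^+ 2) * x1 * x2 +
       (1 + p ^+ 2) / (1 - p ^+ 2) * x2 ^+ 2 + 2 * t / (1 - m) * x1 * x3 +
       2 * m / (1 - m) * x2 * x3 + (1 + m) / (1 - m) * x3 ^+ 2 =
    m / (1 - m) * (x2 + x3) ^+ 2 + p ^+ 2 / (1 - p ^+ 2) * (x1 + x2) ^+ 2 +
    ((1 - m) ^+ 2 + m * (p ^+ 2 - m)) / ((1 - p ^+ 2) * (1 - m)) * x2 ^+ 2 +
    (x3 + t * x1) ^+ 2 / (1 - m) +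
    ((1 - t ^+ 2) * (1 - p ^+ 2) + (p ^+ 2 - m) + 2 * p * (1 - m)) /
      ((1 - p ^+ 2) * (1 - m)) * x1 ^+ 2.
  by field; rewrite !gt_eqF.
have C_ge0 : 0 <= p ^+ 2 - m by rewrite subr_ge0.
have T_ge0 : 0 <= 1 - t ^+ 2 by rewrite subr_ge0.
have [A_ge0 B_ge0] := (ltW A_gt0, ltW B_gt0).
by rewrite !(A_ge0, B_ge0, C_ge0, T_ge0, sqr_ge0, ler0n, invr_ge0, addr_ge0,
  mulr_ge0).
Qed.

Lemma TIF3_quad_ge0 (R : realType) (z : R) : z < 0 ->
  TIF3_Heun z \in unitmx /\
  forall x : 'cV[R]_3, 0 <= (x^T *m diff_mx (@TIF3_Heun R) z *m x) 0 0.
Proof.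
move=> z_lt0; pose p := expR (z / 3).
have p_gt0 : 0 < p by exact: expR_gt0.
have p_le1 : p <= 1 by rewrite ltW// expR_lt1; lra.
(* Three times the exponential bound gives $p(3-z)\le3$; add $p\le1$. This yields the upper bound on
   $s$. *)
have p_le : p * (4 - z) <= 4 by have := expR_mul1B_le1 (z / 3); rewrite -/p; nra.
have ppE : expR (2 * z / 3) = p ^+ 2 by rewrite -expRM_natl mulrA.
pose q := p ^+ 2 * (4 - z) - 3 * z.
have AE : TIF3_Heun z =
    heun_mx (1 / (3 - z)) (2 / (3 * p - 2 * z)) (p ^+ 2 / q) (3 / q).
  by rewrite /TIF3_Heun ppE.
have q_gt0 : 0 < q.
  by rewrite addr_gt0 ?mulr_gt0 ?exprn_gt0//; lra.
have z3_gt0 : 0 < 3 - z by lra.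
have pz_gt0 : 0 < 3 * p - 2 * z by lra.
have a0 : 1 / (3 - z) != 0 by rewrite gt_eqF ?divr_gt0.
have b0 : 2 / (3 * p - 2 * z) != 0 by rewrite gt_eqF ?divr_gt0.
have d0 : 3 / q != 0 by rewrite gt_eqF ?divr_gt0.
split=> [|x]; first by rewrite AE heun_unit.
rewrite (heun_quad _ AE)//= !invf_div divr1.
have -> : p ^+ 2 / q / (1 / (3 - z) * (3 / q)) = p ^+ 2 / 3 * (3 - z).
  by field; rewrite !gt_eqF.
apply: le_trans (@tif3_form_ge0 _ p (p ^+ 2 * (4 - z) / 3) (- z)
  (x 0 0) (x 1 0) (x 2%:R 0) _ _ _) _.
- by rewrite ltW.
- by rewrite oppr_ge0 ltW.
- by apply/andP; split; nra.
- by rewrite le_eqVlt; apply/predU1P; left; rewrite /q; field.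
Qed.

Lemma NIF3_quad_ge0 (R : realType) (z : R) : z < 0 ->
  NIF3_Heun z \in unitmx /\
  forall x : 'cV[R]_3, 0 <= (x^T *m diff_mx (@NIF3_Heun R) z *m x) 0 0.
Proof.
move=> z_lt0; pose p := expR (z / 3).
have p_gt0 : 0 < p by exact: expR_gt0.
have p_lt1 : p < 1 by rewrite expR_lt1; lra.
have p_le : p * (1 - z / 3) <= 1 by exact: expR_mul1B_le1.
have p2E : expR (2 * z / 3) = p ^+ 2 by rewrite -expRM_natl mulrA.
have p3E : expR z = p ^+ 3 by rewrite -expRM_natl mulrC divfK.
(* Chosen so that the last diagonal entry becomes $(m-1)/z$, of the same shape as the other two. *)
pose m := p ^+ 3 * (1 - z / 4).
have AE : NIF3_Heun z = heun_mx ((p - 1) / z) ((p ^+ 2 - 1) / z) (p ^+ 3 / 4)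
    ((m - 1) / z).
  have -> : (m - 1) / z = (p ^+ 3 - 1) / z - p ^+ 3 / 4.
    by rewrite /m; field; rewrite lt_eqF.
  by rewrite /NIF3_Heun p2E p3E.
have pp_lt1 : p ^+ 2 < 1 by rewrite exprn_ilt1// ltW.
have m_gt0 : 0 < m by rewrite mulr_gt0 ?exprn_gt0//; lra.
have m_le : m <= p ^+ 2.
  rewrite /m exprSr -mulrA ler_piMr ?sqr_ge0//; nra.
have z0 : z != 0 by rewrite lt_eqF.
have p1 : p - 1 != 0 by rewrite lt_eqF ?subr_lt0.
have pp1 : p ^+ 2 - 1 != 0 by rewrite lt_eqF ?subr_lt0.
have m1 : m - 1 != 0 by rewrite lt_eqF ?subr_lt0 ?(le_lt_trans m_le).
have a0 : (p - 1) / z != 0 by rewrite mulf_neq0 ?invr_eq0.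
have b0 : (p ^+ 2 - 1) / z != 0 by rewrite mulf_neq0 ?invr_eq0.
have d0 : (m - 1) / z != 0 by rewrite mulf_neq0 ?invr_eq0.
split=> [|x]; first by rewrite AE heun_unit.
rewrite (heun_quad _ AE)//= !invf_div.
(* The contribution of $c/(ad)$ to the $x_1x_3$ coefficient, in the normalization where $d^{-1}+z$
   contributes $m$. Since $-zp\le3(1-p)$, it lies in $[0,1]$, as does $m$, whence $|m-r|\le1$. *)
pose r := - z * p ^+ 3 / (4 * (1 - p)).
have r_ge0 : 0 <= r.
  by rewrite divr_ge0 ?mulr_ge0 ?exprn_ge0//; lra.
have r_le1 : r <= 1.
  rewrite ler_pdivrMr ?mul1r; last by lra.
  have -> : - z * p ^+ 3 = p ^+ 2 * (- z * p) by ring.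
  by rewrite (le_trans (ler_piMl _ (ltW pp_lt1)))// ?mulr_ge0//; lra.
have t_le1 : (m - r) ^+ 2 <= 1.
  have -> : 1 = (m - r) ^+ 2 + (1 - (m - r)) * (1 + (m - r)) by ring.
  by rewrite lerDl mulr_ge0//; lra.
apply: le_trans (mulr_ge0 (_ : 0 <= - z / 2)
  (@nif3_form_ge0 _ p m (m - r) (x 0 0) (x 1 0) (x 2%:R 0) _ _ t_le1)) _.
- by lra.
- by rewrite ltW.
- by rewrite ltW.
- rewrite le_eqVlt; apply/predU1P; left; rewrite /r; field.
  have oneB (w : R) : w - 1 != 0 -> 1 - w != 0 by rewrite !subr_eq0 eq_sym.
  by rewrite m1 z0 p1 pp1 !oneB.
Qed.

Theorem theorem4p1 (R : realType) (M : nat) (Lh : 'M[R]_M) (G g : R -> R)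
    (lg kappa tau : R)
    (Lh_spd : sym_posdef Lh)
    (G_ge0 : forall x : R, 0 <= G x)
    (G_derivable : forall x : R, derivable G x 1)
    (gE : forall x : R, g x = - derive1 G x)
    (lg_gt0 : 0 < lg)
    (g_lipschitz : lg.-lipschitz g)
    (kappa_ge : 2 * lg <= kappa)
    (tau_gt0 : 0 < tau) :
  preserves_dissipation_law (@TIF3_Heun R) Lh G g kappa tau /\
  preserves_dissipation_law (@NIF3_Heun R) Lh G g kappa tau.
Proof.
split; apply: (dissipation_criterion Lh_spd G_derivable gE lg_gt0 g_lipschitz
  kappa_ge tau_gt0) => z z_lt0; try exact: heun_trig.
- by case: (TIF3_quad_ge0 z_lt0).
- by case: (TIF3_quad_ge0 z_lt0).
- by case: (NIF3_quad_ge0 z_lt0).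
- by case: (NIF3_quad_ge0 z_lt0).
Qed.
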